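(* Let $t\ge 2$ and $k\ge 1$ be integers. If $n\ge 2k+\left\lfloor \frac{k-1}{2^{t-1}-1}\right\rfloor$, then every coloring of the edges of $K_n$ with $t$ colors contains a matching of size $k$ whose edges use at most $t-1$ distinct colors. This is sharp: for $n=2k-1+\left\lfloor \frac{k-1}{2^{t-1}-1}\right\rfloor$ there is a coloring of the edges of $K_n$ with $t$ colors containing no matching of size $k$ whose edges use at most $t-1$ distinct colors.
   Context: A matching in an edge-colored complete graph is called $s$-colored if at most $s$ distinct colors appear on its edges. *)

(* Defs.v *)
(* MathComp *)
From mathcomp Require Import all_boot.

Set Implicit Arguments.
Unset Strict Implicit.
Unset Printing Implicit Defensive.

(* The edges of the complete graph K_n on the vertex set 'I_n. *)
Definition edge (n : nat) : finType := {e : {set 'I_n} | #|e| == 2}.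

(* Not every color has to be used. *)
Definition coloring (n t : nat) : Type := edge n -> 'I_t.

Definition is_matching (n : nat) (M : {set edge n}) : Prop :=
  forall e f : edge n, e \in M -> f \in M -> e != f ->
    [disjoint val e & val f].

Definition colored (s n t : nat) (c : coloring n t) (M : {set edge n}) : Prop :=
  #|[set c e | e in M]| <= s.

Definition has_colored_matching (s k n t : nat) (c : coloring n t) : Prop :=
  exists M : {set edge n}, [/\ is_matching M, #|M| = k & colored s c M].

(* Main.v *)
(* Upper bound.  Let d = n - 2(k - 1).  If the edges avoiding color i contain no
   matching of size k, the Tutte-Berge formula yields a set S_i whose removal
   leaves at least |S_i| + d components, and all edges between them have color i.
   For i <> j the vertices outside both S_i and S_j lie in a single component of
   one of the two colors, say i; then S_j swallows all other i-components, so
   |S_j| >= |S_i| + d - 1.  The swallowed sets are disjoint for distinct i, hence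
   |S_j| is at least the sum of |S_i| + d - 1 over all i with |S_i| < |S_j|.
   These sums double, so the largest S_j has at least (2^(t-1) - 1)(d - 1) >= k
   vertices, which leaves too little room for its components.
   Lower bound.  With q = floor((k-1) / (2^(t-1)-1)), give level i = 1, ..., t - 1
   to 2^(t-1-i) q vertices and level 0 to the others; the color of an edge is the
   larger level of its ends. *)
Require Import Defs.
From mathcomp Require Import all_boot zify.

Set Implicit Arguments.
Unset Strict Implicit.
Unset Printing Implicit Defensive.

(** * A weak Tutte-Berge theorem by way of Gallai's lemma *)

Section WeakTutteBerge.
Variable T : finType.
Implicit Types (E M N : {set {set T}}) (S : {set T}) (u v w x y : T).

Definition matching E M := (M \subset E) && trivIset M.

Definition max_matching E M :=
  matching E M && [forall N, matching E N ==> (#|N| <= #|M|)].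

Definition two_uniform E := forall e, e \in E -> #|e| = 2.

Lemma card_cover_matching E M :
  two_uniform E -> matching E M -> #|cover M| = 2 * #|M|.
Proof.
move=> gE /andP[/subsetP sME /eqP <-].
rewrite (eq_bigr (fun _ => 2)) => [|e eM]; last by rewrite gE // sME.
by rewrite sum_nat_const mulnC.
Qed.

Lemma max_matchingP E M :
  reflect (matching E M /\ forall N, matching E N -> #|N| <= #|M|)
          (max_matching E M).
Proof.
apply: (iffP andP) => -[mM /= maxM]; split=> //.
  by move=> N mN; have /forallP/(_ N) := maxM; rewrite mN.
by apply/forallP => N; apply/implyP/maxM.
Qed.

Lemma max_matching_card E M N :
  max_matching E M -> matching E N -> #|N| = #|M| -> max_matching E N.
Proof.
move=> /max_matchingP[_ maxM] mN eqNM; apply/max_matchingP; split=> // L mL.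
by rewrite eqNM maxM.
Qed.

Lemma ex_max_matching E : exists M, max_matching E M.
Proof.
have m0 : matching E set0.
  by rewrite /matching sub0set; apply/trivIsetP=> A B; rewrite inE.
have := arg_maxnP (fun M => #|M|) m0; case=> M mM maxM.
by exists M; apply/max_matchingP.
Qed.

Lemma matchingU1 E M a :
  two_uniform E -> matching E M -> a \in E -> [disjoint a & cover M] ->
  matching E (a |: M) /\ a \notin M.
Proof.
move=> gE /andP[sM tM] aE dis.
have a0 : set0 \notin M.
  by apply/negP=> /(subsetP sM)/gE; rewrite cards0.
have disM B : B \in M -> [disjoint a & B].
  move=> BM; apply: disjointWr dis; exact: (bigcup_sup B).
have aM : a \notin M.
  apply/negP=> aM; have := disM _ aM; rewrite -setI_eq0 setIid => /eqP a00.
  by rewrite -a00 aM in a0.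
split=> //; rewrite /matching subUset sub1set aE sM /=.
apply/trivIsetP => A B /setU1P[->|AM] /setU1P[->|BM]; rewrite ?eqxx // => nAB.
- exact: disM.
- by rewrite disjoint_sym disM.
- by move/trivIsetP: tM => /(_ _ _ AM BM nAB).
Qed.

Lemma matchingS E M N : N \subset M -> matching E M -> matching E N.
Proof.
move=> sNM /andP[sM tM]; rewrite /matching (subset_trans sNM sM) /=.
exact: (trivIsetS sNM).
Qed.

(* Following Gallai and Lovasz: as long as N covers both u and w, an edge of M
   can be exchanged into N, which decreases |M \ N|. *)
Lemma gallai_exchange E M N u v w :
  two_uniform E -> max_matching E M -> max_matching E N -> u != w ->
  u \notin cover M -> w \notin cover M -> v \notin cover N ->
  exists N', [/\ max_matching E N', v \notin cover N' &
                 (u \notin cover N') || (w \notin cover N')].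
Proof.
move=> gE xM; elim: {N}_.+1 {-2}N (ltnSn #|M :\: N|) => // m IH N ltm xN.
move=> neq uM wM vN.
have [ub|uN] := boolP (u \notin cover N); first by exists N; rewrite ub.
have [wb|wN] := boolP (w \notin cover N); first by exists N; rewrite wb orbT.
rewrite !negbK in uN wN.
have [/max_matchingP[mM maxM] /max_matchingP[mN maxN]] := (xM, xN).
have eqMN : #|M| = #|N| by apply/eqP; rewrite eqn_leq maxM ?maxN.
have : 2 <= #|cover N :\: cover M|.
  have <- : #|[set u; w]| = 2 by rewrite cards2 neq.
  by apply: subset_leq_card; rewrite subUset !sub1set !inE uN wN uM wM.
have cc : #|cover M| = #|cover N|.
  by rewrite !(card_cover_matching gE) // eqMN.
(* Both covers have the same size, so [cover M :\: cover N] also has at least two elements, and one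
   of them, [x], differs from [v]. *)
rewrite cardsD setIC -cc -cardsD => card2.
have /card_gt0P[x] : 0 < #|(cover M :\: cover N) :\ v|.
  have := cardsD1 v (cover M :\: cover N); lia.
rewrite !inE => /and3P[xv xN' /bigcupP[a aM xa]].
have [sME tM] := andP mM; have [sNE tN] := andP mN.
have aE : a \in E by apply: (subsetP sME).
have [dis|/pred0Pn[y /andP[/= ya /bigcupP[b bN yb]]]] :=
    boolP [disjoint a & cover N].
  have [mN' aN] := matchingU1 gE mN aE dis.
  by have := maxN _ mN'; rewrite cardsU1 aN add1n ltnn.
have yN : y \in cover N by apply/bigcupP; exists b.
have xy : x != y by apply: contraNneq xN' => ->.
have ea : a = [set x; y].
  apply/esym/eqP; rewrite eqEcard subUset !sub1set xa ya /=.
  by rewrite cards2 xy (gE _ aE).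
have bM : b \notin M.
  apply/negP => bM; have nab : a != b.
    by apply: contraNneq xN' => ab; apply/bigcupP; exists b; rewrite // -ab.
  move/trivIsetP: tM => /(_ _ _ aM bM nab) /pred0P/(_ y) /=.
  by rewrite ya yb.
(* Swapping [b] for [a] keeps the size of [N], leaves [v] uncovered and gains an edge of [M] for an
   edge outside [M]. *)
have mNb : matching E (N :\ b) by apply: matchingS mN; exact: subsetDl.
have dis : [disjoint a & cover (N :\ b)].
  apply/pred0Pn => -[z /andP[/= za /bigcupP[b' /setD1P[nb b'N] zb']]].
  move: za zb'; rewrite ea => /set2P[->|->] zb'.
    by case/negP: xN'; apply/bigcupP; exists b'.
  by move/trivIsetP: tN => /(_ _ _ b'N bN nb) /pred0P/(_ y); rewrite /= zb' yb.
have [mN' aN] := matchingU1 gE mNb aE dis.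
have cN' : #|a |: N :\ b| = #|N|.
  by rewrite cardsU1 aN (cardsD1 b N) bN.
have xN1 := max_matching_card xN mN' cN'.
apply: (IH _ _ xN1) => //.
  apply: leq_trans (ltm : _ <= m); apply: proper_card; apply/properP; split.
    apply/subsetP=> z; rewrite !inE => /andP[]; rewrite !negb_or negb_and negbK.
    by case/andP=> _ /orP[/eqP->|-> ->//]; rewrite (negPf bM).
  have aN0 : a \notin N.
    by apply: contraNN xN' => ?; apply/bigcupP; exists a.
  by exists a; rewrite !inE ?eqxx // aM aN0.
apply/bigcupP => -[b' /setU1P[->|/setD1P[_ b'N]] vb'].
  by move: vb'; rewrite ea => /set2P[]vz; [rewrite vz eqxx in xv|rewrite vz yN in vN].
by case/negP: vN; apply/bigcupP; exists b'.
Qed.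

(* The labels are the classes of "equal, or never missed together by a maximum
   matching"; transitivity is Gallai's lemma. *)
Lemma gallai_labeling E :
  two_uniform E -> (forall v, exists2 M, max_matching E M & v \notin cover M) ->
  exists f : T -> {set T},
    (forall x y, [set x; y] \in E -> f x = f y) /\
    (forall M, max_matching E M -> {in ~: cover M &, injective f}).
Proof.
move=> gE miss.
pose r x y := (x == y) || [forall M, max_matching E M ==>
  ((x \in cover M) || (y \in cover M))].
have rP x y M : r x y -> max_matching E M -> x \notin cover M ->
  y \notin cover M -> x = y.
  case/orP=> [/eqP //|/forallP/(_ M)/implyP h xM xc yc].
  by have := h xM; rewrite (negPf xc) (negPf yc).
have rxx x : r x x by rewrite /r eqxx.
have rC x y : r x y = r y x.
  by rewrite /r eq_sym; congr orb; apply: eq_forallb => M; rewrite orbC.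
have rT x y z : r x y -> r y z -> r x z.
  move=> rxy ryz; have [->//|nxz] := eqVneq x z.
  apply/orP; right; apply/forallP => M; apply/implyP => xM.
  apply/norP => -[xc zc].
  have [N xN yN] := miss y.
  have [N' [xN' yN' /orP[uN|uN]]] := gallai_exchange gE xM xN nxz xc zc yN.
    have exy := rP _ _ _ rxy xN' uN yN'.
    by rewrite exy in nxz xc; have := rP _ _ _ ryz xM xc zc; apply/eqP.
  have eyz := rP _ _ _ ryz xN' yN' uN.
  by rewrite -eyz in nxz zc; have := rP _ _ _ rxy xM xc zc; apply/eqP.
exists (fun x => [set y | r x y]); split.
  move=> x y xyE; have rxy : r x y.
    apply/orP; right; apply/forallP => M; apply/implyP => /max_matchingP[mM maxM].
    apply/norP => -[xc yc].
    have dis : [disjoint [set x; y] & cover M].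
      apply/pred0Pn => -[z /andP[/= /set2P[->|->]]]; exact/negP.
    have [mN aN] := matchingU1 gE mM xyE dis.
    by have := maxM _ mN; rewrite cardsU1 aN add1n ltnn.
  apply/setP => z; rewrite !inE; apply/idP/idP; last exact: rT.
  by apply: rT; rewrite rC.
move=> M xM x y; rewrite !inE => xc yc /setP/(_ y); rewrite !inE rxx => rxy.
exact: rP rxy xM xc yc.
Qed.

(* The labels f stand for the components of the graph minus S; unlike in the
   Tutte-Berge formula, they are not required to be odd. *)
Lemma weak_tutte_berge E k :
  two_uniform E -> (forall M, matching E M -> #|M| <= k) ->
  exists S (f : T -> {set T}),
    (forall x y, x \notin S -> y \notin S -> f x != f y -> [set x; y] \notin E) /\
    #|S| + #|T| <= #|f @: ~: S| + 2 * k.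
Proof.
elim: {E}_.+1 {-2}E (ltnSn #|E|) k => // m IH E ltm k gE.
have [M0 xM0] := ex_max_matching E.
move=> maxk; have /max_matchingP[mM0 max0] := xM0.
have le0k := maxk _ mM0.
have [/forallP all_miss|] :=
    boolP [forall v, [exists M, max_matching E M && (v \notin cover M)]].
  have [|f [fE finj]] := gallai_labeling gE.
    by move=> v; have /existsP[M /andP[? ?]] := all_miss v; exists M.
  exists set0, f; split=> [x y _ _|].
    by apply: contraNN => /fE ->.
  (* The vertices missed by [M0] have distinct labels, and there are [#|T| - 2 * #|M0|] of them. *)
  rewrite cards0 add0n; apply: (@leq_trans (#|f @: ~: cover M0| + 2 * #|M0|)).
    rewrite (card_in_imset (finj _ xM0)) -(card_cover_matching gE mM0).
    by rewrite addnC cardsC.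
  apply: leq_add; last by rewrite leq_mul2l.
  by apply: subset_leq_card; apply: imsetS; apply/subsetP => x; rewrite !inE.
(* Now every maximum matching covers [v]: deleting the edges at [v] lowers the matching number, and
   [v] joins the removed set. *)
case/forallPn => v /existsPn hv.
have cov M : max_matching E M -> v \in cover M.
  by move=> xM; have := hv M; rewrite xM negbK.
pose E' := [set e in E | v \notin e].
have sE : E' \subset E by apply/subsetP => e; rewrite inE => /andP[].
have vM0 := cov _ xM0; have /bigcupP[e0 e0M ve0] := vM0.
have e0E : e0 \in E by case/andP: mM0 => /subsetP->.
have ltE : #|E'| < m.
  apply: leq_trans (ltm : _ <= m); apply: proper_card; apply/properP; split=> //.
  by exists e0; rewrite ?inE ?ve0 ?andbF.
have gE' : two_uniform E' by move=> e /(subsetP sE)/gE.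
have k0 : 0 < #|M0| by apply/card_gt0P; exists e0.
have [|S [f [fE cS]]] := IH _ ltE k.-1 gE'.
  move=> M /andP[sM tM]; have mM : matching E M.
    by rewrite /matching tM andbT (subset_trans sM).
  have : #|M| != #|M0|; last by have := max0 _ mM; lia.
  apply/eqP=> /(max_matching_card xM0 mM)/cov/bigcupP[e /(subsetP sM)].
  by rewrite inE => /andP[_ /negP].
exists (v |: S), f; split=> [x y|].
  rewrite !inE !negb_or => /andP[xv xS] /andP[yv yS] nf.
  apply: contraNN (fE x y xS yS nf) => xyE.
  by rewrite !inE xyE eq_sym (negPf xv) eq_sym (negPf yv).
have : #|f @: ~: S| <= (#|f @: ~: (v |: S)|).+1.
  apply: (@leq_trans #|f v |: f @: ~: (v |: S)|); last by rewrite cardsU1; lia.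
  apply: subset_leq_card; apply/subsetP => z /imsetP[x]; rewrite inE => xS ->.
  have [->|xv] := eqVneq x v; first exact: setU11.
  by apply/setU1r/imset_f; rewrite !inE negb_or xv.
have := leq_b1 (v \notin S); rewrite cardsU1; lia.
Qed.

End WeakTutteBerge.

(** * Labelings of which no two separate the same pair *)

Section Multipartite.
Variables (I T L : finType) (S : I -> {set T}) (f : I -> T -> L) (e : nat).
Hypothesis sep : forall i j x y, i != j -> x \notin S i -> y \notin S i ->
  x \notin S j -> y \notin S j -> (f i x == f i y) || (f j x == f j y).
Hypothesis e0 : 0 < e.
Hypothesis parts : forall i, #|S i| + e < #|f i @: ~: S i|.

(* W i j is the common domain of the two labelings, and X i j collects the parts
   of f i that do not meet it. *)
Let W i j := ~: S i :&: ~: S j.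
Let X i j := [set x in ~: S i | f i x \notin f i @: W i j].

Let constW i j := [forall x in W i j, forall y in W i j, f i x == f i y].

Lemma sub_removed i j : X i j \subset S j.
Proof.
apply/subsetP => x; rewrite inE => /andP[xi]; apply: contraNT => xj.
by apply: imset_f; rewrite inE xi inE.
Qed.

(** At most one label of [f i] occurs on [W i j]; all the others occur on [X i j]. *)
Lemma card_removed i j : constW i j -> #|S i| + e <= #|X i j|.
Proof.
move=> cW; have W1 : #|f i @: W i j| <= 1.
  apply/card_le1_eqP => _ _ /imsetP[x xW ->] /imsetP[y yW ->].
  by move/forall_inP/(_ _ xW)/forall_inP/(_ _ yW)/eqP: cW.
have : #|f i @: ~: S i| <= #|f i @: X i j| + #|f i @: W i j|.
  apply: leq_trans (leq_card_setU _ _); apply: subset_leq_card.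
  apply/subsetP => z /imsetP[x xi ->]; rewrite inE.
  case: (boolP (f i x \in f i @: W i j)) => [_|nW]; first by rewrite orbT.
  by rewrite orbF imset_f // inE xi.
have := leq_imset_card (f i) (X i j); have := parts i; lia.
Qed.

(** Two equivalence relations that together cover all pairs cannot both be proper: if [f i]
    separates [x] and [y], a vertex [z] that [f j] separates from them would share its [f i]-label
    with both. *)
Lemma constW_or i j : i != j -> constW i j || constW j i.
Proof.
move=> nij; case: (boolP (constW i j)) => //=.
case/forall_inPn => x xW /forall_inPn[y yW nxy].
have key z w : z \in W i j -> w \in W i j -> f j z != f j w -> f i z = f i w.
  rewrite !inE => /andP[zi zj] /andP[wi wj] /negPf njzw.
  by have := sep nij zi wi zj wj; rewrite njzw orbF => /eqP.
have jxy : f j x = f j y by apply/eqP; apply: contraNT nxy => /key->.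
have jx z : z \in W i j -> f j z = f j x.
  move=> zW; apply/eqP; apply: contraNT nxy => nzx.
  by rewrite -(key z x) // -(key z y) // -jxy.
apply/forall_inP => z; rewrite /W setIC => zW.
by apply/forall_inP => w wW; rewrite !jx.
Qed.

(** Otherwise [constW j i] would force at least [#|S j| + e] vertices into [S i]. *)
Lemma constW_lt i j : i != j -> #|S i| <= #|S j| -> constW i j.
Proof.
move=> nij le; case/orP: (constW_or nij) => // /card_removed.
have := subset_leq_card (sub_removed j i); lia.
Qed.

Lemma card_removed_inj : injective (fun i => #|S i|).
Proof.
move=> i j /= eij; apply/eqP/contraT => nij.
have := card_removed (constW_lt nij (eq_leq eij)).
have := subset_leq_card (sub_removed i j); lia.
Qed.

(** This makes [X h j] and [X i j] disjoint, as [X i j] avoids [S i]. If some [x] in [X h j] escaped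
    [S i], then [S i] would contain every part of [f h] but that of [x], hence also [W h j];
    counting the labels of [f h] and [f j] then contradicts [#|S i| < #|S j|]. *)
Lemma removed_sub h i j :
  #|S h| < #|S i| -> #|S i| < #|S j| -> X h j \subset S i.
Proof.
move=> lthi ltij; have lthj := ltn_trans lthi ltij.
have nhi : h != i by apply: contraTneq lthi => ->; rewrite ltnn.
have nhj : h != j by apply: contraTneq lthj => ->; rewrite ltnn.
apply/subsetP => x; rewrite inE => /andP[xh nfx]; apply: contraT => xi.
have chi := constW_lt nhi (ltnW lthi); have chj := constW_lt nhj (ltnW lthj).
have xW : x \in W h i by rewrite inE xh inE.
have sub y : y \in ~: S h -> f h y != f h x -> y \in S i.
  move=> yh; apply: contraNT => yi.
  have yW : y \in W h i by rewrite inE yh inE.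
  by move/forall_inP/(_ _ yW)/forall_inP/(_ _ xW): chi.
have sWi : W h j \subset S i.
  apply/subsetP => y yW; have := yW; rewrite inE => /andP[yh _].
  apply: sub => //; apply: contraNneq nfx => <-; exact: imset_f.
have W1 : #|f h @: W h j| <= 1.
  apply/card_le1_eqP => _ _ /imsetP[y yW ->] /imsetP[z zW ->].
  by move/forall_inP/(_ _ yW)/forall_inP/(_ _ zW)/eqP: chj.
have cW : #|~: S j| <= #|W h j| + #|S h|.
  apply: leq_trans (leq_card_setU _ _); apply: subset_leq_card.
  by apply/subsetP => y; rewrite !inE => ->; case: (y \in S h).
pose R := S i :\: W h j.
(* Apart from the label of [x] and the at most one label on [W h j], every label of [f h] occurs on
   [R]. *)
have : #|f h @: ~: S h| <= #|f h @: R| + #|f h x |: f h @: W h j|.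
  apply: leq_trans (leq_card_setU _ _); apply: subset_leq_card.
  apply/subsetP => z /imsetP[y yh ->]; rewrite in_setU in_setU1.
  case: (eqVneq (f h y) (f h x)) => [_|nyx]; first by rewrite orbT.
  case: (boolP (f h y \in f h @: W h j)) => [_|nW]; first by rewrite !orbT.
  rewrite imset_f // inE (sub y) // andbT.
  by apply: contraNN nW => yW; apply: imset_f.
have := leq_imset_card (f h) R; have := leq_imset_card (f j) (~: S j).
have := parts h; have := parts j.
have := cardsD (S i) (W h j); rewrite -/R (setIidPr sWi).
have := subset_leq_card sWi; rewrite cardsU1; move: (_ \notin _) => b.
lia.
Qed.

Lemma sum_removed j :
  \sum_(i | #|S i| < #|S j|) (#|S i| + e) <= #|S j|.
Proof.
pose F i := if #|S i| < #|S j| then X i j else set0.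
have dis i h : i != h -> [disjoint F i & F h].
  wlog: i h / #|S i| <= #|S h|.
    move=> wl nih; case/orP: (leq_total #|S i| #|S h|) => le; first exact: wl.
    by rewrite disjoint_sym wl // eq_sym.
  rewrite leq_eqVlt => /orP[/eqP/card_removed_inj->|ltih _]; first by rewrite eqxx.
  rewrite /F; case: ifP => // _; last by rewrite disjoints_subset sub0set.
  case: ifP => [lthj|_]; last by rewrite disjoint_sym disjoints_subset sub0set.
  apply: disjointWl (removed_sub ltih lthj) _.
  by apply/pred0Pn => -[x /andP[/= xh]]; rewrite !inE xh.
apply: (@leq_trans (\sum_i #|F i|)).
  rewrite big_mkcond; apply: leq_sum => i _; rewrite /F.
  case: ifP => // lt; apply/card_removed/constW_lt/ltnW => //.
  by apply: contraTneq lt => ->; rewrite ltnn.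
rewrite (eq_bigr (fun i => \sum_(x in F i) 1)) => [|i _]; last by rewrite sum1_card.
rewrite -partition_disjoint_bigcup //= sum1_card; apply: subset_leq_card.
apply/bigcupsP => i _; rewrite /F; case: ifP => _; [exact: sub_removed|exact: sub0set].
Qed.

End Multipartite.

(** * Numbers that dominate sums over all smaller ones *)

Lemma doubling_sum (I : finType) (s : I -> nat) (e : nat) :
  injective s -> (forall j, \sum_(i | s i < s j) (s i + e) <= s j) ->
  forall A : {set I}, 2 ^ #|A| * e <= \sum_(i in A) (s i + e) + e.
Proof.
move=> inj hs A; move cA: #|A| => m; elim: m A cA => [|m IH] A cA.
  by rewrite mul1n leq_addl.
have /card_gt0P[j0 j0A] : 0 < #|A| by rewrite cA.
(* The largest value dominates the sum over the rest of [A], so adding [j] back at least doubles the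
   bound. *)
have [j] := arg_maxnP s j0A; move=> jA0 jmax; have jA : j \in A := jA0.
have := cardsD1 j A; rewrite jA cA => -[/esym/IH IHj].
rewrite (big_setD1 j jA) /=.
have : \sum_(i in A :\ j) (s i + e) <= s j.
  apply: leq_trans (hs j); rewrite [leqRHS](bigID (mem (A :\ j))) /=.
  apply: leq_trans (leq_addr _ _); apply: eq_leq; apply: eq_bigl => i.
  case iA: (i \in A :\ j); rewrite ?andbF // andbT; apply/esym.
  move: iA; rewrite !inE => /andP[nij iA].
  by rewrite ltn_neqAle (inj_eq inj) nij; apply: jmax.
rewrite expnS -mulnA; lia.
Qed.

Lemma doubling_max (I : finType) (s : I -> nat) (e : nat) :
  injective s -> (forall j, \sum_(i | s i < s j) (s i + e) <= s j) ->
  0 < #|I| -> exists j, (2 ^ (#|I| - 1) - 1) * e <= s j.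
Proof.
move=> inj hs /card_gt0P[j0 j0I].
have [j _ jmax0] := arg_maxnP s j0I; exists j.
have jmax i : s i <= s j by exact: jmax0.
have := doubling_sum inj hs [set~ j]; rewrite cardsC1 -subn1.
have -> : \sum_(i in [set~ j]) (s i + e) = \sum_(i | s i < s j) (s i + e).
  by apply: eq_bigl => i; rewrite !inE ltn_neqAle (inj_eq inj) jmax andbT.
have := hs j; rewrite mulnBl; lia.
Qed.

(** * Every coloring of a large enough complete graph has the matching *)

Section Upper.
Variables (n t : nat) (c : coloring n t).

(** Edges become plain sets here, so that the results on set families apply. *)
Definition avoiding (i : 'I_t) : {set {set 'I_n}} :=
  [set val e | e in [set e : edge n | c e != i]].

Lemma avoiding_two_uniform i : two_uniform (avoiding i).
Proof. by move=> _ /imsetP[e _ ->]; apply/eqP/(valP e). Qed.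

Lemma avoiding_colored k i (M : {set {set 'I_n}}) :
  matching (avoiding i) M -> k <= #|M| -> has_colored_matching (t - 1) k c.
Proof.
move=> mM0 leM0.
have [N0 sN0 cN0] : exists2 N : {set {set 'I_n}}, N \subset M & #|N| = k.
  have /card_gt0P[N] : 0 < #|[set N : {set {set 'I_n}} | N \subset M & #|N| == k]|.
    by rewrite cards_draws bin_gt0.
  by rewrite inE => /andP[? /eqP]; exists N.
have /andP[sN tN] := matchingS sN0 mM0.
pose N := [set e : edge n | val e \in N0].
have eN : [set val e | e in N] = N0.
  apply/setP => a; apply/imsetP/idP => [[e]|aN0]; first by rewrite inE => ? ->.
  have /imsetP[e _ ea] := subsetP sN _ aN0.
  by exists e; rewrite // inE -ea.
exists N; split.
- move=> a b; rewrite !inE => aN bN nab; move/trivIsetP: tN; apply=> //.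
- by rewrite -cN0 -eN card_imset //; exact: val_inj.
- rewrite /colored subn1 -[X in _ <= X.-1](card_ord t) -(cardsC1 i).
  apply: subset_leq_card; apply/subsetP => _ /imsetP[e eM ->]; rewrite !inE.
  rewrite inE in eM; have /imsetP[e' e'i /val_inj ->] := subsetP sN _ eM.
  by rewrite inE in e'i.
Qed.

Lemma upper_bound k : 2 <= t -> 1 <= k ->
  2 * k + (k - 1) %/ (2 ^ (t - 1) - 1) <= n -> has_colored_matching (t - 1) k c.
Proof.
move=> t2 k1 len.
have [/existsP[i /existsP[M /andP[mM leM]]]|/existsPn none] :=
    boolP [exists i, exists M, matching (avoiding i) M && (k <= #|M|)].
  exact: avoiding_colored mM leM.
have few i M : matching (avoiding i) M -> #|M| <= k - 1.
  move=> mM; have /existsPn/(_ M) := none i; rewrite mM /=; lia.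
have /fin_all_exists[Sf Sfp] i : exists p : {set 'I_n} * ('I_n -> {set 'I_n}),
    (forall x y, x \notin p.1 -> y \notin p.1 -> p.2 x != p.2 y ->
       [set x; y] \notin avoiding i) /\
    #|p.1| + n <= #|p.2 @: ~: p.1| + 2 * (k - 1).
  have [S [f H]] := weak_tutte_berge (@avoiding_two_uniform i) (few i).
  by exists (S, f); rewrite card_ord in H.
set q := (k - 1) %/ _ in len.
pose S i := (Sf i).1; pose f i := (Sf i).2.
(* An edge separated by both labelings would have both colors [i] and [j]. *)
have sep i j x y : i != j -> x \notin S i -> y \notin S i ->
    x \notin S j -> y \notin S j -> (f i x == f i y) || (f j x == f j y).
  move=> nij xi yi xj yj; apply: contraT; rewrite negb_or => /andP[ni nj].
  have exy : #|[set x; y]| == 2.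
    by rewrite cards2 (contraNneq _ ni) // => ->.
  have := (Sfp i).1 _ _ xi yi ni; have := (Sfp j).1 _ _ xj yj nj.
  pose a : edge n := Sub [set x; y] exy.
  have av l : [set x; y] \notin avoiding l -> c a = l.
    move=> nl; apply/eqP; apply: contraNT nl => nl.
    by apply/imsetP; exists a; rewrite ?inE.
  by move=> /av ej /av ei; move: nij; rewrite -ei -ej eqxx.
(* The surplus [e] is [q.+1], because [n - 2 * (k - 1)] is at least [q + 2]. *)
have parts i : #|S i| + q.+1 < #|f i @: ~: S i|.
  have := (Sfp i).2; rewrite -/(S i) -/(f i); lia.
have inj := card_removed_inj sep (ltn0Sn q) parts.
have [|j] := doubling_max inj (sum_removed sep (ltn0Sn q) parts).
  by rewrite card_ord; lia.
rewrite card_ord => leS.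
have p2 : 0 < 2 ^ (t - 1) - 1.
  by rewrite subn_gt0 -[1]/(2 ^ 0) ltn_exp2l // subn_gt0.
have ltk : k - 1 < (2 ^ (t - 1) - 1) * q.+1 by rewrite mulnC ltn_ceil.
(* Now at most [n - k] vertices lie outside [S j], yet they would need at least [n - k + 2]
   labels. *)
have {}leS : k - 1 < #|S j| := leq_trans ltk leS.
have le1 : #|S j| + n <= #|f j @: ~: S j| + 2 * (k - 1) := (Sfp j).2.
have le2 : #|f j @: ~: S j| <= #|~: S j| := leq_imset_card _ _.
have : #|S j| + #|~: S j| = n by rewrite cardsC card_ord.
lia.
Qed.

End Upper.

(** * The extremal coloring by levels *)

Section Lower.
Variables (m q n : nat).

(** For [0 < i], the vertices of level at least [i] are those numbered below [height i]. *)
Definition height i := (2 ^ (m.+1 - i) - 1) * q.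

Definition level (x : nat) : nat := \max_(i < m.+1 | x < height i) i.

Definition level_coloring : coloring n m.+1 :=
  fun e => inord (\max_(x in val e) level x).

Lemma height_leq i j : i <= j -> height j <= height i.
Proof. by move=> ij; rewrite leq_mul2r leq_sub2r ?orbT // leq_pexp2l // leq_sub2l. Qed.

Lemma heightS i : i <= m -> height i = 2 * height i.+1 + q.
Proof.
move=> im; rewrite /height subSS subSn // expnS.
have := expn_gt0 2 (m - i); move: (2 ^ _) => a /=; nia.
Qed.

Lemma level_leq x : level x <= m.
Proof. by apply/bigmax_leqP => i _; rewrite -ltnS. Qed.

Lemma leq_level i x : 0 < i -> i <= m.+1 -> (i <= level x) = (x < height i).
Proof.
move=> i0; rewrite leq_eqVlt => /orP[/eqP->|im].
  by rewrite /height subnn mul0n ltn0 ltnNge level_leq.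
apply/idP/idP => [|xi]; last exact: (leq_bigmax_cond (Ordinal im)).
apply: contraLR => xi; rewrite -ltnNge -(prednK i0) ltnS.
apply/bigmax_leqP => j xj; rewrite -ltnS prednK //.
by rewrite ltnNge; apply: contraNN xi => /height_leq; apply: leq_trans.
Qed.

Lemma sum_level i : height 1 <= n -> 0 < i -> i <= m.+1 ->
  \sum_(x < n) (i <= level x) = height i.
Proof.
move=> hn i0 im; rewrite -[RHS]muln1 -[X in X * 1]card_ord -sum_nat_const.
rewrite (big_ord_widen n (fun=> 1)) ?(leq_trans (height_leq i0)) // [RHS]big_mkcond.
by apply: eq_bigr => x _; rewrite leq_level //; case: ifP.
Qed.

(* Every edge that avoids color i has weight at least 2: if it meets level i,
   then its other end has a higher level. *)
Definition weight i (x : nat) : nat := if i < level x then 2 else level x < i.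

(** Total weights thus reduce to counts of levels, which [sum_level] evaluates. *)
Lemma weightE i x : weight i x + (i <= level x) = 1 + 2 * (i < level x).
Proof. by rewrite /weight; case: ltngtP. Qed.

Lemma edge_weight i (e : edge n) :
  level_coloring e != i -> 2 <= \sum_(x in val e) weight i x.
Proof.
have /cards2P[x [y [nxy ee]]] := valP e.
rewrite /level_coloring ee !(big_setU1, big_set1) ?inE //= => nc.
have : maxn (level x) (level y) != i.
  apply: contraNneq nc => mi; apply/eqP/val_inj; rewrite /= inordK //.
  by rewrite ltnS geq_max !level_leq.
rewrite /weight /maxn; case: (ltngtP (level x) i); case: (ltngtP (level y) i).
all: by move=> /= hy hx; case: ifP; move: hx hy; lia.
Qed.

Lemma matching_weight i (M : {set edge n}) :
  is_matching M -> i \notin [set level_coloring e | e in M] ->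
  2 * #|M| <= \sum_(x < n) weight i x.
Proof.
move=> mM iM.
have tM : trivIset [set val e | e in M].
  apply/trivIsetP => _ _ /imsetP[a aM ->] /imsetP[b bM ->] nab.
  by apply: mM => //; apply: contraNneq nab => ->.
apply: (@leq_trans (\sum_(x in cover [set val e | e in M]) weight i x)).
  rewrite big_trivIset //= big_imset => [|a b _ _]; last exact: val_inj.
  rewrite mulnC -sum_nat_const; apply: leq_sum => e eM; apply: edge_weight.
  by apply: contraNneq iM => <-; apply: imset_f.
by rewrite [leqRHS](bigID (mem (cover [set val e | e in M]))) leq_addr.
Qed.

(** A matching with at most [m] colors misses some color [i]. The total weight is
    [n - q = 2 * k - 1] if [0 < i], and [2 * height 1 <= 2 * (k - 1)] if [i = 0]; either is less
    than the [2 * k] that [k] edges require. *)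
Lemma lower_bound k : 1 <= k -> height 1 <= k - 1 -> n = 2 * k - 1 + q ->
  ~ has_colored_matching m k level_coloring.
Proof.
move=> k1 hk en [M [mM cM]]; rewrite /colored => colM.
have /subsetPn[i _ iM] : ~~ ([set: 'I_m.+1] \subset [set level_coloring e | e in M]).
  apply/negP => /subset_leq_card; rewrite cardsT card_ord => /leq_trans/(_ colM).
  by rewrite ltnn.
have := matching_weight mM iM; rewrite cM.
have hn : height 1 <= n by lia.
have : \sum_(x < n) weight i x + \sum_(x < n) (i <= level x) =
       n + 2 * \sum_(x < n) (i < level x).
  rewrite -big_split /=; under eq_bigr do rewrite weightE.
  rewrite big_split /=.
  by rewrite big_distrr sum1_card card_ord.
rewrite (sum_level (i := i.+1)) //.
have := heightS (i := i); rewrite -ltnS ltn_ord => /(_ isT).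
have [->|i0] := posnP i; last by rewrite (sum_level hn i0 (ltnW (ltn_ord i))); lia.
by rewrite sum1_card card_ord; lia.
Qed.

End Lower.

Theorem theorem14 (t k : nat) (ht : 2 <= t) (hk : 1 <= k) :
  (forall n : nat, 2 * k + (k - 1) %/ (2 ^ (t - 1) - 1) <= n ->
     forall c : coloring n t, has_colored_matching (t - 1) k c) /\
  (forall n : nat, n = 2 * k - 1 + (k - 1) %/ (2 ^ (t - 1) - 1) ->
     exists c : coloring n t, ~ has_colored_matching (t - 1) k c).
Proof.
split=> [n len c|]; first exact: upper_bound len.
case: t ht => // m _ n en; rewrite subSS subn0 in en *.
exists (@level_coloring m ((k - 1) %/ (2 ^ m - 1)) n); apply: lower_bound en => //.
(* Here [height 1] is the divisor times the quotient, hence at most [k - 1]. *)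
by rewrite /height subSS subn0 mulnC leq_divM.
Qed.
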